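(* Let $\mathcal{T}=\mathcal{C}_{A_n}$ and let $\mathcal{C}\subseteq\mathcal{T}$ be the additive subcategory corresponding to a Ptolemy diagram of the regular $(n+3)$-gon $P$. Let $c\in\mathcal{C}$ be $\operatorname{Ext}$-projective in $\mathcal{C}$ and indecomposable (so $c$ is a dissecting diagonal). Let the vertices of the two cells bordered by $c$ be $v_1<v_2<\cdots<v_m$, with $c=\{v_i,v_j\}$. Choose $v_p$ maximal in $[v_i^+,v_j^-]$ such that $b_0:=\{v_i,v_p\}\in\mathcal{C}$ and $v_q$ maximal in $[v_j^+,v_i^-]$ such that $b_1:=\{v_j,v_q\}\in\mathcal{C}$. Let $$\beta=(\beta_0,\beta_1):b_0\oplus b_1\rightarrow c,$$ where $\beta_0,\beta_1$ are non-zero morphisms (unless $b_0$ or $b_1$ are zero). Then $\beta$ is a minimal right almost split morphism in $\mathcal{C}$, and there is a distinguished triangle in $\mathcal{T}$ $$x\xrightarrow{\xi=\begin{pmatrix}\xi_0\\ \xi_1\end{pmatrix}} b_0\oplus b_1\xrightarrow{\beta=(\beta_0,\beta_1)} c\rightarrow\Sigma x$$ with $x=\{v_p,v_q\}$ indecomposable not in $\mathcal{C}$ and $\xi$ a $\mathcal{C}$-envelope of $x$. In other words, this triangle is a left-weak Auslander-Reiten triangle in $\mathcal{C}$.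
   Context: Additive subcategory means a full subcategory closed under isomorphisms, finite direct sums and direct summands. $\mathcal{T}=\mathcal{C}_{A_n}$ is the cluster category of the linearly oriented quiver of type $A_n$ over $\mathbb{C}$; it is a $\mathbb{C}$-linear $\operatorname{Hom}$-finite Krull-Schmidt $2$-Calabi-Yau triangulated category with suspension $\Sigma$, and $\operatorname{Ext}^1(X,Y):=\operatorname{Hom}_{\mathcal{T}}(X,\Sigma Y)$. Geometric model: let $P$ be the regular polygon with $n+3$ vertices, labelled anticlockwise; the anticlockwise direction is the positive one. For a vertex $v$, $v^+$ is the next vertex anticlockwise and $v^-$ the next vertex clockwise. For vertices, $u<v<w$ means that they appear in the order $u,v,w$ when going through the vertices in the positive direction (cyclic order); $[u,v]$ is the interval of vertices met when going from $u$ to $v$ in the positive direction, totally ordered by $<$. Isomorphism classes of indecomposables of $\mathcal{T}$ are identified with diagonals $\{x_0,x_1\}$ of $P$ between non-neighbouring vertices; edges $\{v,v^+\}$ of $P$ are identified with the zero object (in particular they count as belonging to $\mathcal{C}$). Two diagonals cross if they intersect in the interior of $P$ (endpoints excluded). For indecomposables $a,c$: $\dim_{\mathbb{C}}\operatorname{Ext}^1(a,c)=1$ if the diagonals cross and $0$ otherwise; $\Sigma\{a_0,a_1\}=\{a_0^-,a_1^-\}$. If $a=\{a_0,a_1\}$ and $c=\{c_0,c_1\}$ cross, with $a_1<c_1<a_0<c_0$ in the cyclic order, then completing the non-zero morphisms $c\to\Sigma a$ and $a\to\Sigma c$ gives distinguished triangles $a\to\{c_1,a_0\}\oplus\{c_0,a_1\}\to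 c\to\Sigma a$ and $c\to\{a_0,c_0\}\oplus\{a_1,c_1\}\to a\to\Sigma c$. For indecomposables $z=\{z_0,z_1\}$ and $x=\{x_0,x_1\}$, $\operatorname{Hom}(z,x)\neq0$ if and only if $z$ has one endpoint in each of the intervals $[x_0^{++},x_1]$ and $[x_1^{++},x_0]$. A Ptolemy diagram of $P$ is a set of diagonals of $P$ such that whenever it contains crossing diagonals $a$ and $b$, it also contains all the diagonals connecting the endpoints of $a$ and $b$. Ptolemy diagrams of $P$ correspond to the additive subcategories of $\mathcal{T}$ closed under extensions (the diagram being the set of indecomposables of the subcategory). Each Ptolemy diagram is obtained by first choosing a set of pairwise non-crossing diagonals of $P$, called dissecting diagonals, which divide $P$ into cells, and then deciding for each cell whether it is an empty cell (none of the diagonals of the cell is included) or a clique (all diagonals of the cell are included). Conventions: the indices of $v_1,\dots,v_m$ are cyclic, $v_0:=v_m$. The indecomposable $\operatorname{Ext}$-projectives of $\mathcal{C}$ are exactly the dissecting diagonals. Definitions: $C\in\mathcal{C}$ is $\operatorname{Ext}$-projective in $\mathcal{C}$ if $\operatorname{Ext}^1(C,A)=0$ for all $A\in\mathcal{C}$. A morphism $\beta:B\to C$ with $B,C\in\mathcal{C}$ is right almost split in $\mathcal{C}$ if it is not a split epimorphism and every morphism $C'\to C$ with $C'\in\mathcal{C}$ which is not a split epimorphism factors through $\beta$. A morphism $\xi:X\to Y$ is right minimal if $\xi\circ\varphi=\xi$ with $\varphi:X\to X$ implies $\varphi$ is an automorphism; left minimal if $\varphi\circ\xi=\xi$ with $\varphi:Y\to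 Y$ implies $\varphi$ is an automorphism. Minimal right almost split in $\mathcal{C}$ means right minimal and right almost split in $\mathcal{C}$. A $\mathcal{C}$-envelope of $X\in\mathcal{T}$ is a left minimal morphism $X\to B$ with $B\in\mathcal{C}$ through which every morphism from $X$ to an object of $\mathcal{C}$ factors. A distinguished triangle $X\xrightarrow{\xi}B\xrightarrow{\beta}C\to\Sigma X$ is a left-weak Auslander-Reiten triangle in $\mathcal{C}$ if $C$ is $\operatorname{Ext}$-projective in $\mathcal{C}$, $\beta$ is minimal right almost split in $\mathcal{C}$ and $\xi$ is a $\mathcal{C}$-envelope of $X$. *)

(* Defs.v *)
(* The complex numbers are R[i] for R : realType. *)
From HB Require Import structures.
From mathcomp Require Export all_boot all_order all_algebra.
From mathcomp Require Export complex reals.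
From mathcomp Require Import zify.

Set Implicit Arguments.
Unset Strict Implicit.
Unset Printing Implicit Defensive.

Import Order.TTheory GRing.Theory Num.Theory.
Local Open Scope ring_scope.

(* Hom-finiteness is built in: [vectType K] is the type of finite-dimensional
   K-vector spaces. *)
Record linCat (K : fieldType) := LinCat {
  obj :> Type;
  hom : obj -> obj -> vectType K;
  idm : forall X, hom X X;
  comp : forall X Y Z, hom Y Z -> hom X Y -> hom X Z;
  comp_linl : forall X Y Z (f : hom X Y), linear (fun g : hom Y Z => comp g f);
  comp_linr : forall X Y Z (g : hom Y Z), linear (fun f : hom X Y => comp g f);
  compA : forall X Y Z W (h : hom Z W) (g : hom Y Z) (f : hom X Y),
    comp h (comp g f) = comp (comp h g) f;
  comp1m : forall X Y (f : hom X Y), comp (idm Y) f = f;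
  compm1 : forall X Y (f : hom X Y), comp f (idm X) = f
}.

Arguments hom {K l} X Y.
Arguments idm {K l} X.
Notation "g \oc f" := (comp g f) (at level 40, left associativity).

Section LinearCategories.
Variables (K : fieldType) (A : linCat K).
Implicit Types X Y Z : A.

Definition is_zero X : Prop := idm X = 0.

Definition is_iso X Y (f : hom X Y) : Prop :=
  exists g : hom Y X, g \oc f = idm X /\ f \oc g = idm Y.

Definition isomorphic X Y : Prop := exists f : hom X Y, is_iso f.

Definition split_epi X Y (f : hom X Y) : Prop :=
  exists s : hom Y X, f \oc s = idm Y.

Definition is_dsum X k (Z : 'I_k -> A) : Prop :=
  exists (i : forall a, hom (Z a) X) (p : forall a, hom X (Z a)),
    [/\ forall a, p a \oc i a = idm (Z a),
        forall a b, a != b -> p a \oc i b = 0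
      & \sum_(a < k) (i a \oc p a) = idm X].

Definition local_end X : Prop :=
  ~ is_zero X /\ forall f : hom X X, is_iso f \/ is_iso (idm X - f).

Definition krull_schmidt : Prop :=
  forall X, exists k (Z : 'I_k -> A), is_dsum X Z /\ forall a, local_end (Z a).

Definition right_minimal X Y (f : hom X Y) : Prop :=
  forall h : hom X X, f \oc h = f -> is_iso h.

Definition left_minimal X Y (f : hom X Y) : Prop :=
  forall h : hom Y Y, h \oc f = f -> is_iso h.

End LinearCategories.

Arguments krull_schmidt {K} A.

Record addCat (K : fieldType) := AddCat {
  addCat_linCat :> linCat K;
  zero_obj : addCat_linCat;
  zero_objP : is_zero zero_obj;
  dsum : addCat_linCat -> addCat_linCat -> addCat_linCat;
  in0 : forall X Y, hom X (dsum X Y);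
  in1 : forall X Y, hom Y (dsum X Y);
  pr0 : forall X Y, hom (dsum X Y) X;
  pr1 : forall X Y, hom (dsum X Y) Y;
  pr0_in0 : forall X Y, pr0 X Y \oc in0 X Y = idm X;
  pr1_in1 : forall X Y, pr1 X Y \oc in1 X Y = idm Y;
  pr0_in1 : forall X Y, pr0 X Y \oc in1 X Y = 0;
  pr1_in0 : forall X Y, pr1 X Y \oc in0 X Y = 0;
  in_pr : forall X Y,
    in0 X Y \oc pr0 X Y + in1 X Y \oc pr1 X Y = idm (dsum X Y)
}.

Arguments zero_obj {K} a.
Arguments dsum {K a} X Y.
Arguments in0 {K a} X Y.
Arguments in1 {K a} X Y.
Arguments pr0 {K a} X Y.
Arguments pr1 {K a} X Y.

Section AdditiveCategories.
Variables (K : fieldType) (A : addCat K).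
Implicit Types X Y Z : A.

Definition row_mor Y Z X (f : hom Y X) (g : hom Z X) : hom (dsum Y Z) X :=
  f \oc pr0 Y Z + g \oc pr1 Y Z.

Definition col_mor X Y Z (f : hom X Y) (g : hom X Z) : hom X (dsum Y Z) :=
  in0 Y Z \oc f + in1 Y Z \oc g.

Definition indecomposable X : Prop :=
  ~ is_zero X /\
  forall Y Z, isomorphic X (dsum Y Z) -> is_zero Y \/ is_zero Z.

(* A full subcategory is given by the predicate "belongs to C" on objects. *)
Record additive_subcat (C : A -> Prop) : Prop := AdditiveSubcat {
  asub_iso : forall X Y, isomorphic X Y -> C X -> C Y;
  asub_zero : C (zero_obj A);
  asub_dsum : forall X Y, C X -> C Y -> C (dsum X Y);
  asub_summand : forall X Y, C (dsum X Y) -> C X /\ C Y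
}.

End AdditiveCategories.

Record linFunctor (K : fieldType) (A B : linCat K) := LinFunctor {
  fobj :> A -> B;
  fmap : forall X Y, hom X Y -> hom (fobj X) (fobj Y);
  fmap_lin : forall X Y, linear (@fmap X Y);
  fmap1 : forall X, fmap (idm X) = idm (fobj X);
  fmapM : forall X Y Z (g : hom Y Z) (f : hom X Y),
    fmap (g \oc f) = fmap g \oc fmap f
}.

Arguments fmap {K A B} l {X Y} f.

Section Functors.
Variable K : fieldType.

Definition compF (A B D : linCat K) (G : linFunctor B D) (F : linFunctor A B) :
  linFunctor A D.
Proof.
exists (fun X => G (F X)) (fun X Y f => fmap G (fmap F f)).
- by move=> X Y a f g; rewrite !fmap_lin.
- by move=> X; rewrite !fmap1.
- by move=> X Y Z g f; rewrite !fmapM.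
Defined.

Record natIso (A B : linCat K) (F G : linFunctor A B) := NatIso {
  nfwd : forall X : A, hom (F X) (G X);
  nbwd : forall X : A, hom (G X) (F X);
  nbwdK : forall X, nfwd X \oc nbwd X = idm (G X);
  nfwdK : forall X, nbwd X \oc nfwd X = idm (F X);
  nnat : forall X Y (f : hom X Y), nfwd Y \oc fmap F f = fmap G f \oc nfwd X
}.

Definition equivalence (A B : linCat K) (F : linFunctor A B) : Prop :=
  (forall X Y, bijective (fun f : hom X Y => fmap F f)) /\
  (forall Z : B, exists X, isomorphic (F X) Z).

(* A natural isomorphism Hom(X, Y) -> Hom(Y, S X)^* is given by the associated
   perfect pairing. *)
Definition serre_functor (A : linCat K) (S : linFunctor A A) : Prop :=
  equivalence S /\
  exists t : forall X Y : A, hom X Y -> hom Y (S X) -> K,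
    [/\ forall X Y (g : hom Y (S X)), scalar (fun f : hom X Y => t X Y f g),
        forall X Y (f : hom X Y), scalar (fun g : hom Y (S X) => t X Y f g),
        forall X Y,
          (forall f : hom X Y, (forall g, t X Y f g = 0) -> f = 0) /\
          (forall g : hom Y (S X), (forall f, t X Y f g = 0) -> g = 0),
        forall X Y Y' (h : hom Y Y') (f : hom X Y) (g : hom Y' (S X)),
          t X Y' (h \oc f) g = t X Y f (g \oc h)
      & forall X X' Y (e : hom X' X) (f : hom X Y) (g : hom Y (S X')),
          t X' Y (f \oc e) g = t X Y f (fmap S e \oc g)].

End Functors.

Record triCat (K : fieldType) := TriCat {
  triCat_addCat :> addCat K;
  shift : linFunctor triCat_addCat triCat_addCat;
  shift_equiv : equivalence shift;
  dist : forall X Y Z,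
    hom X Y -> hom Y Z -> hom Z (shift X) -> Prop;
  dist_iso : forall X Y Z (f : hom X Y) (g : hom Y Z) (h : hom Z (shift X))
    X' Y' Z' (f' : hom X' Y') (g' : hom Y' Z') (h' : hom Z' (shift X'))
    (u : hom X X') (v : hom Y Y') (w : hom Z Z'),
    is_iso u -> is_iso v -> is_iso w ->
    v \oc f = f' \oc u -> w \oc g = g' \oc v ->
    fmap shift u \oc h = h' \oc w ->
    dist f g h -> dist f' g' h';
  dist_id : forall X,
    dist (idm X) (0 : hom X (zero_obj triCat_addCat)) 0;
  dist_cone : forall X Y (f : hom X Y),
    exists Z (g : hom Y Z) (h : hom Z (shift X)), dist f g h;
  dist_rot : forall X Y Z (f : hom X Y) (g : hom Y Z) (h : hom Z (shift X)),
    dist f g h <-> dist g h (- fmap shift f);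
  dist_mor : forall X Y Z (f : hom X Y) (g : hom Y Z) (h : hom Z (shift X))
    X' Y' Z' (f' : hom X' Y') (g' : hom Y' Z') (h' : hom Z' (shift X'))
    (u : hom X X') (v : hom Y Y'),
    dist f g h -> dist f' g' h' -> v \oc f = f' \oc u ->
    exists w : hom Z Z',
      w \oc g = g' \oc v /\ fmap shift u \oc h = h' \oc w;
  dist_octa : forall X Y Z Z' X' Y' (f : hom X Y) (g : hom Y Z)
    (a1 : hom Y Z') (a2 : hom Z' (shift X))
    (b1 : hom Z X') (b2 : hom X' (shift Y))
    (c1 : hom Z Y') (c2 : hom Y' (shift X)),
    dist f a1 a2 -> dist g b1 b2 -> dist (g \oc f) c1 c2 ->
    exists (u : hom Z' Y') (v : hom Y' X'),
      [/\ dist u v (fmap shift a1 \oc b2),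
          u \oc a1 = c1 \oc g, c2 \oc u = a2, v \oc c1 = b1
        & b2 \oc v = fmap shift f \oc c2]
}.

Arguments shift {K} t.

Definition two_calabi_yau (K : fieldType) (T : triCat K) : Prop :=
  serre_functor (compF (shift T) (shift T)).

Definition Ext1 (K : fieldType) (T : triCat K) (X Y : T) : vectType K :=
  hom X (shift T Y).

Section Subcategories.
Variables (K : fieldType) (T : triCat K) (C : T -> Prop).

Definition ext_projective (X : T) : Prop :=
  C X /\ forall A, C A -> forall f : Ext1 X A, f = 0.

Definition right_almost_split (B X : T) (b : hom B X) : Prop :=
  [/\ C B, C X, ~ split_epi b
    & forall Y (f : hom Y X), C Y -> ~ split_epi f ->
        exists g : hom Y B, b \oc g = f].

Definition minimal_right_almost_split (B X : T) (b : hom B X) : Prop :=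
  right_minimal b /\ right_almost_split b.

Definition envelope (X B : T) (e : hom X B) : Prop :=
  [/\ C B, left_minimal e
    & forall Y (f : hom X Y), C Y -> exists g : hom B Y, g \oc e = f].

Definition left_weak_AR_triangle (X B Y : T)
    (e : hom X B) (b : hom B Y) (d : hom Y (shift T X)) : Prop :=
  [/\ dist e b d, ext_projective Y, minimal_right_almost_split b & envelope e].

End Subcategories.

(* Finite-dimensional representations of 0 -> 1 -> ... -> n-1. *)
Record rep (K : fieldType) (n : nat) := Rep {
  rsp :> 'I_n -> vectType K;
  rmap : forall i j : 'I_n, val j = (val i).+1 -> 'Hom(rsp i, rsp j)
}.

Record repMor (K : fieldType) (n : nat) (V W : rep K n) := RepMor {
  rfun :> forall i, 'Hom(V i, W i);
  rfun_nat : forall (i j : 'I_n) (e : val j = (val i).+1) (x : V i),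
    rfun j (rmap V e x) = rmap W e (rfun i x)
}.

Record cpx (K : fieldType) (n : nat) := Cpx {
  cx :> int -> rep K n;
  cd : forall k, repMor (cx k) (cx (k + 1));
  cd2 : forall k i (x : cx k i), cd (k + 1) i (cd k i x) = 0;
  cbounded : exists N : nat,
    forall k : int, (N < `|k|)%N -> forall i (x : cx k i), x = 0
}.

Record cpxMor (K : fieldType) (n : nat) (X Y : cpx K n) := CpxMor {
  cfun :> forall k, repMor (X k) (Y k);
  cfun_d : forall k i (x : X k i),
    cfun (k + 1) i (cd X k i x) = cd Y k i (cfun k i x)
}.

Section Complexes.
Variables (K : fieldType) (n : nat).

Definition rep_opp (V W : rep K n) (f : repMor V W) : repMor V W.
Proof.
exists (fun i => - f i) => i j e x.
by rewrite !opp_lfunE rfun_nat linearN.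
Defined.

(* X[1]^k = X^(k+1), with differential -d. *)
Definition cshift (X : cpx K n) : cpx K n.
Proof.
exists (fun k => X (k + 1)) (fun k => rep_opp (cd X (k + 1))).
- by move=> k i x; rewrite /= !opp_lfunE linearN /= cd2 !oppr0.
- have [N bX] := cbounded X; exists N.+1 => k ltNk; apply: bX.
  lia.
Defined.

Definition null_homotopic (X Y : cpx K n) (f : cpxMor X Y) : Prop :=
  exists h : forall k, repMor (X (k + 1)) (Y k),
    forall k i (x : X (k + 1) i),
      f (k + 1) i x = cd Y k i (h k i x) + h (k + 1) i (cd X (k + 1) i x).

(* Bijectivity on the cohomology of each degree and each vertex. *)
Definition quasi_iso (X Y : cpx K n) (f : cpxMor X Y) : Prop :=
  forall (k : int) (i : 'I_n),
    (forall (x : X (k + 1) i) (y : Y k i),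
       cd X (k + 1) i x = 0 -> f (k + 1) i x = cd Y k i y ->
       exists x' : X k i, x = cd X k i x') /\
    (forall y : Y (k + 1) i, cd Y (k + 1) i y = 0 ->
       exists (x : X (k + 1) i) (y' : Y k i),
         cd X (k + 1) i x = 0 /\ y = f (k + 1) i x + cd Y k i y').

(* Z^k = X^(k+1) (+) Y^k with d (x, y) = (- d x, f x + d y); [j] is the
   inclusion of Y, [p] the projection to X[1] and [s] the (non-differential)
   inclusion of X[1]. *)
Definition is_mapping_cone (X Y Z : cpx K n) (f : cpxMor X Y)
    (j : cpxMor Y Z) (p : cpxMor Z (cshift X)) : Prop :=
  exists s : forall k, repMor (X (k + 1)) (Z k),
    [/\ forall k i, bijective (fun u : X (k + 1) i * Y k i =>
                                 s k i u.1 + j k i u.2),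
        forall k i (x : X (k + 1) i) (y : Y k i),
          p k i (s k i x + j k i y) = x
      & forall k i (x : X (k + 1) i),
          cd Z k i (s k i x) = j (k + 1) i (f (k + 1) i x)
                               - s (k + 1) i (cd X (k + 1) i x)].

End Complexes.

(* [D] is D^b(rep A_n): the localisation [Q] of bounded complexes at
   quasi-isomorphisms (with its calculus of fractions), the shift and the
   distinguished triangles coming from those of complexes. *)
Record derived_category (K : fieldType) (n : nat) (D : triCat K) :=
    DerivedCategory {
  Qob : cpx K n -> D;
  Qmor : forall X Y : cpx K n, cpxMor X Y -> hom (Qob X) (Qob Y);
  Qmor_id : forall (X : cpx K n) (f : cpxMor X X),
    (forall k i x, f k i x = x) -> Qmor f = idm (Qob X);
  Qmor_comp : forall (X Y Z : cpx K n)
    (g : cpxMor Y Z) (f : cpxMor X Y) (h : cpxMor X Z),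
    (forall k i x, h k i x = g k i (f k i x)) -> Qmor h = Qmor g \oc Qmor f;
  Qmor_lin : forall (X Y : cpx K n) (a : K) (f g h : cpxMor X Y),
    (forall k i x, h k i x = a *: f k i x + g k i x) ->
    Qmor h = a *: Qmor f + Qmor g;
  Q_qis : forall (X Y : cpx K n) (s : cpxMor X Y),
    quasi_iso s -> is_iso (Qmor s);
  Q_dense : forall Z : D, exists X : cpx K n, isomorphic (Qob X) Z;
  Q_full : forall (X Y : cpx K n) (u : hom (Qob X) (Qob Y)),
    exists (X' : cpx K n) (s : cpxMor X' X) (f : cpxMor X' Y),
      quasi_iso s /\ u \oc Qmor s = Qmor f;
  Q_faithful : forall (X Y : cpx K n) (f : cpxMor X Y),
    Qmor f = 0 <->
    exists (X' : cpx K n) (s : cpxMor X' X) (fs : cpxMor X' Y),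
      [/\ quasi_iso s, forall k i x, fs k i x = f k i (s k i x)
        & null_homotopic fs];
  Qshift : forall X : cpx K n, hom (Qob (cshift X)) (shift D (Qob X));
  Qshift_iso : forall X : cpx K n, is_iso (Qshift X);
  Qshift_nat : forall (X Y : cpx K n)
    (f : cpxMor X Y) (f1 : cpxMor (cshift X) (cshift Y)),
    (forall k i x, f1 k i x = f (k + 1) i x) ->
    Qshift Y \oc Qmor f1 = fmap (shift D) (Qmor f) \oc Qshift X;
  Q_dist : forall (X Y Z : cpx K n)
    (f : cpxMor X Y) (j : cpxMor Y Z) (p : cpxMor Z (cshift X)),
    is_mapping_cone f j p ->
    dist (Qmor f) (Qmor j) (Qshift X \oc Qmor p)
}.

Section OrbitCategory.
Variables (K : fieldType) (D T : linCat K).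
Variables (F : linFunctor D D) (P : linFunctor D T) (e : natIso (compF P F) P).

Fixpoint orbit_fwd (i : nat) (Y : D) : hom (P (iter i F Y)) (P Y) :=
  match i return hom (P (iter i F Y)) (P Y) with
  | 0 => idm (P Y)
  | i'.+1 => orbit_fwd i' Y \oc nfwd e (iter i' F Y)
  end.

Fixpoint orbit_bwd (i : nat) (Y : D) : hom (P Y) (P (iter i F Y)) :=
  match i return hom (P Y) (P (iter i F Y)) with
  | 0 => idm (P Y)
  | i'.+1 => nbwd e (iter i' F Y) \oc orbit_bwd i' Y
  end.

(* The image in Hom_T(P X, P Y) of an element of
   (+)_(-N <= i < N) Hom_D(X, F^i Y);
   for negative i, Hom_D(X, F^i Y) is written Hom_D(F^(-i) X, Y). *)
Definition orbit_sum (X Y : D) (N : nat)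
    (f : forall i, hom X (iter i F Y)) (g : forall i, hom (iter i.+1 F X) Y) :
    hom (P X) (P Y) :=
  \sum_(i < N) (orbit_fwd i Y \oc fmap P (f i))
  + \sum_(i < N) (fmap P (g i) \oc orbit_bwd i.+1 X).

(* T is the orbit category D / F, with projection P: it has the objects of D
   and Hom_T(P X, P Y) = (+)_(i in Z) Hom_D(X, F^i Y). *)
Definition orbit_category : Prop :=
  [/\ forall Z : T, exists X, isomorphic (P X) Z,
      forall X Y (h : hom (P X) (P Y)), exists N f g, h = orbit_sum N f g
    & forall X Y N (f : forall i, hom X (iter i F Y))
        (g : forall i, hom (iter i.+1 F X) Y),
        orbit_sum N f g = 0 -> forall i, (i < N)%N -> f i = 0 /\ g i = 0].

End OrbitCategory.

(* T = D^b(rep A_n) / tau^-1 Sigma, where Sigma tau is the Serre functor, with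
   the triangulated structure that makes the projection a triangle functor. *)
Record cluster_category_A (K : fieldType) (n : nat) (T : triCat K) :=
    ClusterCategoryA {
  cl_D : triCat K;
  cl_derived : derived_category n cl_D;
  cl_tau : linFunctor cl_D cl_D;
  cl_tau_serre : serre_functor (compF (shift cl_D) cl_tau);
  cl_F : linFunctor cl_D cl_D;
  cl_F_equiv : equivalence cl_F;
  cl_tauF : natIso (compF cl_tau cl_F) (shift cl_D);
  cl_P : linFunctor cl_D T;
  cl_PF : natIso (compF cl_P cl_F) cl_P;
  cl_orbit : orbit_category cl_PF;
  cl_Pshift : natIso (compF cl_P (shift cl_D)) (compF (shift T) cl_P);
  cl_Pdist : forall (X Y Z : cl_D)
    (f : hom X Y) (g : hom Y Z) (h : hom Z (shift cl_D X)),
    dist f g h ->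
    dist (fmap cl_P f) (fmap cl_P g) (nfwd cl_Pshift X \oc fmap cl_P h)
}.

Section Polygon.
Variable m : nat.
Implicit Types (u v w x y : 'I_m) (a b c d : {set 'I_m}).
Implicit Types (S Pt : {set {set 'I_m}}) (W : {set 'I_m}).

(* The vertices are numbered anticlockwise: v^+ is [ordS v], v^- is [ord_pred v]. *)

Definition steps u v : nat := ((v + (m - u)) %% m)%N.

Definition cyc3 u v w : bool := (0 < steps u v < steps u w)%N.

Definition cyc4 u v w x : bool := cyc3 u v w && cyc3 u w x.

Definition interval u v : {set 'I_m} := [set w | (steps u w <= steps u v)%N].

(* Segments between two vertices are given by the set of their endpoints. *)
Definition diagonal d : bool :=
  [exists u, exists v,
    [&& d == [set u; v], v != u, v != ordS u & u != ordS v]].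

Definition cross a b : bool :=
  [exists a0, exists a1, exists b0, exists b1,
    [&& a == [set a0; a1], b == [set b0; b1] & cyc4 a1 b1 a0 b0]].

Definition ptolemy Pt : Prop :=
  (forall d, d \in Pt -> diagonal d) /\
  (forall a b, a \in Pt -> b \in Pt -> cross a b ->
     forall u v, u \in a -> v \in b -> diagonal [set u; v] ->
       [set u; v] \in Pt).

(* The diagonals bounding the empty cells and cliques of a Ptolemy diagram are
   those of its diagonals that no other one crosses. *)
Definition dissecting Pt : {set {set 'I_m}} :=
  [set d in Pt | [forall b in Pt, ~~ cross d b]].

(* A polygon inscribed in P is given by its set W of vertices; [side W u v]
   says that v is the vertex of W following u. *)
Definition side W u v : bool :=
  [&& u \in W, v \in W, u != v & [forall w in W, ~~ cyc3 u w v]].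

(* Cells of P dissected by S: the sides are edges of P or belong to S, and no
   diagonal in S cuts the cell. *)
Definition is_cell S W : Prop :=
  [/\ (2 < #|W|)%N,
      forall u v, side W u v -> v = ordS u \/ [set u; v] \in S
    & forall u v, u \in W -> v \in W -> [set u; v] \in S ->
        side W u v \/ side W v u].

Definition borders d W : Prop := exists u v, d = [set u; v] /\ side W u v.

(* w is maximal in [u, v] among the vertices satisfying Q. *)
Definition maximal_in u v (Q : 'I_m -> Prop) w : Prop :=
  [/\ w \in interval u v, Q w
    & forall w', w' \in interval u v -> Q w' -> (steps u w' <= steps u w)%N].

End Polygon.

(* [ob d] is the indecomposable identified with the diagonal d; edges of P are
   identified with zero. *)
Record geometric_model (K : fieldType) (T : triCat K) (n : nat)
    (ob : {set 'I_n.+3} -> T) : Prop := GeometricModel {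
  gm_edge : forall v : 'I_n.+3, is_zero (ob [set v; ordS v]);
  gm_indec : forall d, diagonal d -> indecomposable (ob d);
  gm_inj : forall d d', diagonal d -> diagonal d' ->
    isomorphic (ob d) (ob d') -> d = d';
  gm_surj : forall X : T, indecomposable X ->
    exists2 d, diagonal d & isomorphic X (ob d);
  gm_ext : forall a c, diagonal a -> diagonal c ->
    \dim {: Ext1 (ob a) (ob c)} = cross a c;
  gm_shift : forall a0 a1, diagonal [set a0; a1] ->
    isomorphic (shift T (ob [set a0; a1]))
               (ob [set ord_pred a0; ord_pred a1]);
  gm_triangle : forall a0 a1 c0 c1 : 'I_n.+3, cyc4 a1 c1 a0 c0 ->
    let a := ob [set a0; a1] in
    let c := ob [set c0; c1] in
    (forall h : hom c (shift T a), h <> 0 ->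
       exists (f : hom a (dsum (ob [set c1; a0]) (ob [set c0; a1])))
              (g : hom (dsum (ob [set c1; a0]) (ob [set c0; a1])) c),
         dist f g h) /\
    (forall h : hom a (shift T c), h <> 0 ->
       exists (f : hom c (dsum (ob [set a0; c0]) (ob [set a1; c1])))
              (g : hom (dsum (ob [set a0; c0]) (ob [set a1; c1])) a),
         dist f g h);
  gm_hom : forall z x0 x1, diagonal z -> diagonal [set x0; x1] ->
    (exists h : hom (ob z) (ob [set x0; x1]), h <> 0) <->
    (exists z0 z1, [/\ z = [set z0; z1],
       z0 \in interval (ordS (ordS x0)) x1
     & z1 \in interval (ordS (ordS x1)) x0])
}.

(* C is the additive subcategory corresponding to the Ptolemy diagram Pt. *)
Definition corresponds (K : fieldType) (T : triCat K) (n : nat)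
    (ob : {set 'I_n.+3} -> T) (C : T -> Prop) (Pt : {set {set 'I_n.+3}}) :
    Prop :=
  [/\ additive_subcat C, ptolemy Pt
    & forall d, diagonal d -> (d \in Pt <-> C (ob d))].

(* Main.v *)
Require Import Defs.
From mathcomp Require Import zify.

(** Write [c = {u, w}], [b0 = {u, y}], [b1 = {w, y'}] and [x = {y, y'}], with
    [u < y < w < y'] in the cyclic order.  Since [x] and [c] cross, the geometric
    model provides a triangle [x -> b0 (+) b1 -> c -> Sx] whose last morphism
    [h] is non-zero.  All Hom spaces between indecomposables have dimension at
    most one ([hom_collinear]), so after rescaling the summands of the middle
    term the second morphism is [beta], provided that its components are
    non-zero; a vanishing component would make [b0] or [b1] a direct summand of
    the indecomposable [x] ([dist_component_neq0]).

    Everything else is read off from this triangle.  Its two morphisms are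
    minimal because [h] is non-zero and [x] and [c] have only scalar
    endomorphisms ([dist_right_minimal], [dist_left_minimal]).  A morphism from
    [x] to an object [A] of [C] extends to the middle term because the
    obstruction lies in [Ext1 c A], which is zero ([dist_envelope]).  The object
    [x] is not in [C] because it has a non-zero extension with [c].

    The geometry enters in showing that [beta] is right almost split.  The
    obstruction to lifting [k] along [beta] is [h \oc k], and by the
    Krull-Schmidt property [k] may be assumed to start from a diagonal [d] of
    the Ptolemy diagram, distinct from [c] ([dist_right_almost_split]).  If
    [h \oc k] is non-zero, then [d] has a non-zero morphism to [c], does not
    cross [c] and crosses [x].  These conditions force [d] to be, say, [{u, z}]
    with [z] strictly between [y] and [w] ([hom_cross_cases]).  By maximality of
    [y], the vertex [z] is not in the cell, so some side of that cell cuts [z]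
    off; this side is a dissecting diagonal crossed by [d], which is absurd
    ([cell_vertex], [maximal_unpassed]). *)

Set Implicit Arguments.
Unset Strict Implicit.
Unset Printing Implicit Defensive.

Import GRing.Theory.
Local Open Scope ring_scope.

(** * Linear and additive categories *)

Section LinearCategory.
Variables (K : fieldType) (A : linCat K).
Implicit Types X Y Z : A.

Lemma compDl X Y Z (g g' : hom Y Z) (f : hom X Y) :
  (g + g') \oc f = g \oc f + g' \oc f.
Proof. by have := comp_linl f 1 g g'; rewrite !scale1r. Qed.

Lemma compDr X Y Z (g : hom Y Z) (f f' : hom X Y) :
  g \oc (f + f') = g \oc f + g \oc f'.
Proof. by have := comp_linr g 1 f f'; rewrite !scale1r. Qed.

Lemma comp0l X Y Z (f : hom X Y) : (0 : hom Y Z) \oc f = 0.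
Proof. by apply: (addrI (0 \oc f)); rewrite -compDl !addr0. Qed.

Lemma comp0r X Y Z (g : hom Y Z) : g \oc (0 : hom X Y) = 0.
Proof. by apply: (addrI (g \oc 0)); rewrite -compDr !addr0. Qed.

Lemma compZl X Y Z a (g : hom Y Z) (f : hom X Y) :
  (a *: g) \oc f = a *: (g \oc f).
Proof. by have := comp_linl f a g 0; rewrite comp0l !addr0. Qed.

Lemma compZr X Y Z a (g : hom Y Z) (f : hom X Y) :
  g \oc (a *: f) = a *: (g \oc f).
Proof. by have := comp_linr g a f 0; rewrite comp0r !addr0. Qed.

Lemma compNl X Y Z (g : hom Y Z) (f : hom X Y) : (- g) \oc f = - (g \oc f).
Proof. by rewrite -scaleN1r compZl scaleN1r. Qed.

Lemma compNr X Y Z (g : hom Y Z) (f : hom X Y) : g \oc (- f) = - (g \oc f).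
Proof. by rewrite -scaleN1r compZr scaleN1r. Qed.

Lemma comp_sumr X Y Z (g : hom Y Z) k (f : 'I_k -> hom X Y) :
  g \oc (\sum_a f a) = \sum_a g \oc f a.
Proof. by apply: (big_morph _ (compDr g) (comp0r _ g)). Qed.

Lemma zero_src X Y (f : hom X Y) : is_zero X -> f = 0.
Proof. by move=> X0; rewrite -[f]compm1 X0 comp0r. Qed.

Lemma is_iso_id X : is_iso (idm X).
Proof. by exists (idm X); rewrite comp1m. Qed.

Lemma is_iso_scale X a : a != 0 -> is_iso (a *: idm X).
Proof.
move=> a0; exists (a^-1 *: idm X).
by rewrite !compZl !compZr !comp1m !scalerA mulfV // mulVf // scale1r.
Qed.

Lemma is_iso_square_zero X (k : hom X X) :
  k \oc k = 0 -> is_iso (idm X + k).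
Proof.
move=> k2; exists (idm X - k).
by rewrite !compDl !compNl !compDr !compNr !compm1 !comp1m k2 oppr0 !addr0
  subrK addrK.
Qed.

(** All the objects attached to diagonals are of this kind; it stands in for
    the locality of their endomorphism rings. *)
Definition brick X : Prop := forall f : hom X X, exists a, f = a *: idm X.

(** This turns the components of a given triangle into prescribed morphisms.
    The two cases treat a diagonal and an edge of the polygon alike. *)
Lemma rescale X Y (f g : hom X Y) : (~ is_zero X -> g <> 0) ->
  (~ is_zero X -> exists k : K, g = k *: f) ->
  exists2 v : hom X X, is_iso v & f \oc v = g.
Proof.
have [X0|nX] := eqVneq (idm X) 0.
  by exists (idm X); [apply: is_iso_id | rewrite [RHS](zero_src _ X0); apply: zero_src].
have {}nX : ~ is_zero X by apply/eqP.
move=> /(_ nX) g0 /(_ nX) [k gE]; rewrite gE.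
have k0 : k != 0 by apply/eqP => k0; apply: g0; rewrite gE k0 scale0r.
by exists (k *: idm X); [apply: is_iso_scale | rewrite compZr compm1].
Qed.

(** The scalar [g \oc f] is invertible: were it zero, then
    [g = (g \oc f) \oc g] would vanish, and [idm B] with it. *)
Lemma retract_brick B X (g : hom B X) (f : hom X B) :
  brick X -> ~ is_zero B -> f \oc g = idm B -> isomorphic B X.
Proof.
move=> brX nB fg; have [a gf] := brX (g \oc f).
have a0 : a != 0.
  apply/eqP => a0; have : g \oc f \oc g = g by rewrite -compA fg compm1.
  by rewrite gf a0 scale0r comp0l => g0; apply: nB; rewrite /is_zero -fg -g0 comp0r.
have af : a *: f = f by rewrite -[in LHS](compm1 f) -compZr -gf compA fg comp1m.
exists g, (a^-1 *: f); split; last by rewrite compZr gf scalerA mulVf // scale1r.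
by rewrite -af scalerA mulVf // scale1r.
Qed.

End LinearCategory.

Section AdditiveCategory.
Variables (K : fieldType) (A : addCat K).
Implicit Types X Y Z : A.

Lemma col_mor_pr X Y Z (f : hom X (dsum Y Z)) :
  col_mor (pr0 Y Z \oc f) (pr1 Y Z \oc f) = f.
Proof. by rewrite /col_mor !compA -compDl in_pr comp1m. Qed.

Lemma row_mor_in X Y Z (g : hom (dsum Y Z) X) :
  row_mor (g \oc in0 Y Z) (g \oc in1 Y Z) = g.
Proof. by rewrite /row_mor -!compA -compDr in_pr compm1. Qed.

Lemma pr0_col X Y Z (f : hom X Y) (g : hom X Z) :
  pr0 Y Z \oc col_mor f g = f.
Proof. by rewrite compDr !compA pr0_in0 pr0_in1 comp1m comp0l addr0. Qed.

Lemma pr1_col X Y Z (f : hom X Y) (g : hom X Z) :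
  pr1 Y Z \oc col_mor f g = g.
Proof. by rewrite compDr !compA pr1_in0 pr1_in1 comp1m comp0l add0r. Qed.

Lemma row_col X Y Z W (f : hom Y W) (g : hom Z W) (f' : hom X Y) (g' : hom X Z) :
  row_mor f g \oc col_mor f' g' = f \oc f' + g \oc g'.
Proof. by rewrite compDl -!compA pr0_col pr1_col. Qed.

Definition diag_mor Y Z Y' Z' (f : hom Y Y') (g : hom Z Z') :
    hom (dsum Y Z) (dsum Y' Z') :=
  col_mor (f \oc pr0 Y Z) (g \oc pr1 Y Z).

Lemma row_diag Y Z Y' Z' X (f : hom Y Y') (g : hom Z Z')
    (k : hom Y' X) (l : hom Z' X) :
  row_mor k l \oc diag_mor f g = row_mor (k \oc f) (l \oc g).
Proof. by rewrite row_col !compA. Qed.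

Lemma diag_diag Y Z Y' Z' Y'' Z'' (f : hom Y Y') (g : hom Z Z')
    (k : hom Y' Y'') (l : hom Z' Z'') :
  diag_mor k l \oc diag_mor f g = diag_mor (k \oc f) (l \oc g).
Proof.
by rewrite -[LHS]col_mor_pr !compA pr0_col pr1_col -!compA pr0_col pr1_col !compA.
Qed.

Lemma diag_id Y Z : diag_mor (idm Y) (idm Z) = idm (dsum Y Z).
Proof. by rewrite /diag_mor !comp1m /col_mor in_pr. Qed.

Lemma is_iso_diag Y Z Y' Z' (f : hom Y Y') (g : hom Z Z') :
  is_iso f -> is_iso g -> is_iso (diag_mor f g).
Proof.
move=> [f' [f'f ff']] [g' [g'g gg']]; exists (diag_mor f' g').
by rewrite !diag_diag f'f ff' g'g gg' !diag_id.
Qed.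

(** One of the two complementary idempotents defined by a decomposition is
    invertible, which kills the other one together with its image. *)
Lemma local_end_indecomposable X : local_end X -> indecomposable X.
Proof.
move=> [nX locX]; split=> // Y Z [f [g [gf fg]]].
have idem W W' (u : hom W X) (w : hom X W) (w' : hom X W') (u' : hom W' X) :
    w \oc u = idm W -> w \oc u' = 0 -> w' \oc u' = idm W' ->
    is_iso (u \oc w) -> is_zero W'.
  move=> wu wu' w'u' [k [ki _]]; rewrite /is_zero -w'u' -[u']comp1m -ki.
  by rewrite -!compA wu' !comp0r.
have E : idm X - (g \oc in0 Y Z) \oc (pr0 Y Z \oc f)
    = (g \oc in1 Y Z) \oc (pr1 Y Z \oc f).
  apply/eqP; rewrite subr_eq addrC -gf -{1}[f]comp1m -in_pr compDl compDr.
  by rewrite !compA.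
have inv W W' (u : hom W (dsum Y Z)) (w : hom (dsum Y Z) W') :
    (w \oc f) \oc (g \oc u) = w \oc u.
  by rewrite -compA (compA f g) fg comp1m.
case: (locX ((g \oc in0 Y Z) \oc (pr0 Y Z \oc f))); rewrite ?E => iso.
  right; apply: (idem _ _ _ _ (pr1 Y Z \oc f) (g \oc in1 Y Z) _ _ _ iso).
  - by rewrite inv pr0_in0.
  - by rewrite inv pr0_in1.
  by rewrite inv pr1_in1.
left; apply: (idem _ _ _ _ (pr0 Y Z \oc f) (g \oc in0 Y Z) _ _ _ iso).
- by rewrite inv pr1_in1.
- by rewrite inv pr1_in0.
by rewrite inv pr0_in0.
Qed.

End AdditiveCategory.

(** * Triangulated categories *)

Section TriangulatedCategory.
Variables (K : fieldType) (T : triCat K).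
Implicit Types X Y Z W : T.

Lemma fmap0 (A B : linCat K) (F : linFunctor A B) (X Y : A) :
  fmap F (0 : hom X Y) = 0.
Proof.
apply: (addrI (fmap F 0)).
by have := fmap_lin F (X := X) (Y := Y) 1 0 0; rewrite !scale1r !addr0 => <-.
Qed.

Lemma fmapN (A B : linCat K) (F : linFunctor A B) (X Y : A) (f : hom X Y) :
  fmap F (- f) = - fmap F f.
Proof. by have := fmap_lin F (-1) f 0; rewrite fmap0 !addr0 !scaleN1r. Qed.

Lemma shift_inj X Y : injective (fun f : hom X Y => fmap (shift T) f).
Proof. by apply: bij_inj; apply: (shift_equiv T).1. Qed.

Lemma shift_full X Y (k : hom (shift T X) (shift T Y)) :
  exists f : hom X Y, fmap (shift T) f = k.
Proof. by have [g _ gK] := (shift_equiv T).1 X Y; exists (g k); apply: gK. Qed.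

Section Triangle.
Variables (X Y Z : T) (f : hom X Y) (g : hom Y Z) (h : hom Z (shift T X)).
Hypothesis tri : dist f g h.

Lemma dist_comp0 : g \oc f = 0.
Proof.
have [|w [wE _]] := dist_mor (u := idm X) (v := f) (dist_id X) tri.
  by [].
by rewrite -wE comp0r.
Qed.

(** Exactness of [Hom(W, -)]: a lift is the completion of [v] and [0] to a
    morphism from the triangle [W -> 0 -> SW -> SW] to the rotated triangle. *)
Lemma dist_lift W (v : hom W Y) : g \oc v = 0 -> exists u, f \oc u = v.
Proof.
move=> gv; have triW := (dist_rot _ _ _).1 (dist_id W).
have [|w [_ wE]] := dist_mor (u := v) (v := 0) triW ((dist_rot _ _ _).1 tri).
  by rewrite gv comp0r.
have [u uw] := shift_full w; exists u; apply: shift_inj; rewrite /= fmapM uw.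
by move: wE; rewrite fmap1 compNr compm1 compNl => /oppr_inj.
Qed.

(** Exactness of [Hom(-, W)]: an extension is the completion of [0] and [v] to
    a morphism to the triangle [0 -> W -> W -> 0]. *)
Lemma dist_extend W (v : hom Y W) : v \oc f = 0 -> exists u, u \oc g = v.
Proof.
move=> vf.
have S0 : is_zero (shift T (zero_obj T)).
  by rewrite /is_zero -fmap1 (zero_objP T : idm _ = 0) fmap0.
have triW : dist (0 : hom (zero_obj T) W) (idm W)
                 (0 : hom W (shift T (zero_obj T))).
  apply/dist_rot; apply: (dist_iso (u := idm W) (v := idm W)
    (w := (0 : hom (zero_obj T) (shift T (zero_obj T)))) _ _ _ _ _ _ (dist_id W)).
  - exact: is_iso_id.
  - exact: is_iso_id.
  - by exists 0; rewrite !comp0l; split; symmetry; [apply: zero_objP|].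
  - by [].
  - by rewrite !comp0l.
  - by rewrite comp0r [RHS](zero_src _ (zero_objP T)).
have [|w [wE _]] := dist_mor (u := (0 : hom X (zero_obj T))) (v := v) tri triW.
  by rewrite vf comp0r.
by exists w; rewrite wE comp1m.
Qed.

End Triangle.

Section NonsplitTriangle.
Variables (X Y Z : T) (f : hom X Y) (g : hom Y Z) (h : hom Z (shift T X)).
Hypotheses (tri : dist f g h) (h_neq0 : h <> 0).

Lemma dist_not_split_epi : ~ split_epi g.
Proof.
move=> [s gs]; apply: h_neq0; rewrite -[h]compm1 -gs compA.
by rewrite (dist_comp0 ((dist_rot _ _ _).1 tri)) comp0l.
Qed.

Lemma dist_not_split_mono (r : hom Y X) : r \oc f <> idm X.
Proof.
move=> rf; apply: h_neq0; rewrite -[h]comp1m -fmap1 -rf fmapM -compA.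
have := dist_comp0 ((dist_rot _ _ _).1 ((dist_rot _ _ _).1 tri)).
by rewrite compNl => /eqP; rewrite oppr_eq0 => /eqP ->; rewrite comp0r.
Qed.

(** If [g \oc k = g] then [k] is the identity plus some [f \oc u].  The scalar
    [u \oc f] vanishes because [f] is not a split monomorphism, so [f \oc u]
    has square zero. *)
Lemma dist_right_minimal : brick X -> right_minimal g.
Proof.
move=> brX k gk; have [|u fu] := dist_lift tri (v := k - idm Y).
  by rewrite compDr compNr gk compm1 subrr.
have [a uf] := brX (u \oc f).
have uf0 : u \oc f = 0.
  rewrite uf; case: (eqVneq a 0) => [->|a0]; first by rewrite scale0r.
  case: (@dist_not_split_mono (a^-1 *: u)).
  by rewrite compZl uf scalerA mulVf // scale1r.
have -> : k = idm Y + f \oc u by rewrite fu addrC subrK.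
by apply: is_iso_square_zero; rewrite compA -(compA f u f) uf0 comp0r comp0l.
Qed.

Lemma dist_left_minimal : brick Z -> left_minimal f.
Proof.
move=> brZ k kf; have [|u ug] := dist_extend tri (v := k - idm Y).
  by rewrite compDl compNl kf comp1m subrr.
have [a gu] := brZ (g \oc u).
have gu0 : g \oc u = 0.
  rewrite gu; case: (eqVneq a 0) => [->|a0]; first by rewrite scale0r.
  case: dist_not_split_epi; exists (a^-1 *: u).
  by rewrite compZr gu scalerA mulVf // scale1r.
have -> : k = idm Y + u \oc g by rewrite ug addrC subrK.
by apply: is_iso_square_zero; rewrite compA -(compA u g u) gu0 comp0r comp0l.
Qed.

(** The obstruction to extending a morphism [e] from [X] to [A] along [f] is
    the element [fmap (shift T) e \oc h] of [Ext1 Z A]. *)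
Lemma dist_envelope (C : T -> Prop) :
  C Y -> ext_projective C Z -> brick Z -> envelope C f.
Proof.
move=> CY [_ extZ] brZ; split=> // [|A e CA]; first exact: dist_left_minimal.
have tri2 := (dist_rot _ _ _).1 ((dist_rot _ _ _).1 tri).
have [u uE] := dist_extend tri2 (extZ A CA (fmap (shift T) e \oc h)).
have [u' u'E] := shift_full u; exists (- u').
by apply: shift_inj; rewrite /= fmapM fmapN u'E compNl -compNr.
Qed.

End NonsplitTriangle.

(** A summand of the middle term on which [g] vanishes is a retract of [X]. *)
Lemma dist_component_neq0 X Y Z (f : hom X Y) (g : hom Y Z)
    (h : hom Z (shift T X)) B (s : hom B Y) (r : hom Y B) :
  dist f g h -> brick X -> r \oc s = idm B -> ~ is_zero B ->
  ~ isomorphic B X -> g \oc s <> 0.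
Proof.
move=> tri brX rs nB niso gs0; have [t ft] := dist_lift tri gs0.
by apply/niso/(retract_brick (g := t) (f := r \oc f)); rewrite // -compA ft.
Qed.

(** The complement of a split monomorphism is its cone. *)
Lemma retract_summand X Y (i : hom X Y) (p : hom Y X) :
  p \oc i = idm X -> exists Z, isomorphic Y (dsum X Z).
Proof.
move=> pi; have [Z [g [h tri]]] := dist_cone i.
have gi := dist_comp0 tri; have tri1 := (dist_rot _ _ _).1 tri.
have h0 : h = 0.
  have := dist_comp0 ((dist_rot _ _ _).1 tri1).
  rewrite compNl => /eqP; rewrite oppr_eq0 => /eqP ih.
  by rewrite -[h]comp1m -fmap1 -pi fmapM -compA ih comp0r.
have [|s0 gs0] := dist_lift tri1 (v := idm Z); first by rewrite h0 comp0l.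
(* Correct the section [s0] so that [p] kills it. *)
pose s := s0 - i \oc (p \oc s0).
have gs : g \oc s = idm Z by rewrite /s compDr compNr compA gi comp0l subr0.
have ps : p \oc s = 0 by rewrite /s compDr compNr compA pi comp1m subrr.
have [|t it] := dist_lift tri (v := idm Y - i \oc p - s \oc g).
  by rewrite !compDr !compNr !compA gi gs comp0l comp1m compm1 subr0 subrr.
have t0 : t = 0.
  rewrite -[t]comp1m -pi -compA it !compDr !compNr !compA pi ps.
  by rewrite comp0l comp1m compm1 subrr subr0.
move: it; rewrite t0 comp0r => /esym/eqP; rewrite subr_eq0 subr_eq => /eqP idE.
exists Z, (col_mor p g), (row_mor i s); split.
  by rewrite row_col addrC -idE.
rewrite -[LHS]row_mor_in -[RHS]row_mor_in !comp1m; congr row_mor.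
  rewrite -compA /row_mor compDl -!compA pr0_in0 pr1_in0 comp0r compm1 addr0.
  by rewrite compDl -!compA pi gi comp0r compm1 addr0.
rewrite -compA /row_mor compDl -!compA pr0_in1 pr1_in1 comp0r compm1 add0r.
by rewrite compDl -!compA ps gs comp0r compm1 add0r.
Qed.

(** The obstruction to lifting [k] along [g] is [h \oc k], and it can be tested
    on the indecomposable summands of the source of [k]. *)
Lemma dist_right_almost_split (C : T -> Prop) X Y Z
    (f : hom X Y) (g : hom Y Z) (h : hom Z (shift T X)) :
  krull_schmidt T -> additive_subcat C -> dist f g h -> h <> 0 -> C Y -> C Z ->
  (forall W (k : hom W Z), C W -> indecomposable W -> ~ split_epi k ->
     h \oc k = 0) ->
  right_almost_split C g.
Proof.
move=> ksT addC tri hn0 CY CZ rad; split=> //; first exact: dist_not_split_epi tri hn0.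
move=> W k CW nk; apply: (dist_lift ((dist_rot _ _ _).1 tri)).
have [r [V [[i [p [pi _ ip]]] locV]]] := ksT W.
rewrite -[k]compm1 -ip !comp_sumr big1 // => a _.
rewrite !compA -(compA h) (rad (V a)) ?comp0l //.
- have [V' isoV] := retract_summand (pi a).
  by have [] := asub_summand addC (asub_iso addC isoV CW).
- exact: local_end_indecomposable.
by move=> [s ks]; apply: nk; exists (i a \oc s); rewrite compA.
Qed.

Lemma dist_iso_middle X Y Z (f : hom X Y) (g : hom Y Z) (h : hom Z (shift T X))
    Y' (v : hom Y Y') (g' : hom Y' Z) :
  dist f g h -> is_iso v -> g' \oc v = g -> dist (v \oc f) g' h.
Proof.
move=> tri isov gv.
apply: (dist_iso (u := idm X) (v := v) (w := idm Z) _ isov _ _ _ _ tri).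
- exact: is_iso_id.
- exact: is_iso_id.
- by rewrite compm1.
- by rewrite comp1m.
by rewrite fmap1 comp1m compm1.
Qed.

End TriangulatedCategory.

(** * Cyclic order, diagonals and cells *)

Section Polygon.
Variable m : nat.
Implicit Types (u v w x y z : 'I_m) (a b d W : {set 'I_m}).

Lemma steps_cases u v :
  (u <= v /\ steps u v + u = v \/ v < u /\ steps u v + u = v + m)%N.
Proof.
have := ltn_ord u; have := ltn_ord v; rewrite /steps => ltv ltu.
case: (leqP u v) => le; last by right; rewrite modn_small; lia.
by left; rewrite (_ : v + (m - u) = v - u + m)%N ?modnDr ?modn_small; lia.
Qed.

Lemma cyc3E u v w : cyc3 u v w = [|| u < v < w, v < w < u | w < u < v]%N.
Proof.
have := ltn_ord u; have := ltn_ord v; have := ltn_ord w; rewrite /cyc3.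
have := steps_cases u v; have := steps_cases u w; lia.
Qed.

Lemma in_intervalE u v w :
  (w \in interval u v) = [|| u <= w <= v, w <= v < u | v < u <= w]%N.
Proof.
have := ltn_ord u; have := ltn_ord v; have := ltn_ord w; rewrite inE.
have := steps_cases u v; have := steps_cases u w; lia.
Qed.

Lemma ordS_cases u :
  (u.+1 < m /\ ordS u = u.+1 :> nat)%N \/ (u.+1 = m /\ ordS u = 0 :> nat).
Proof.
have := ltn_ord u; rewrite leq_eqVlt => /orP[/eqP e|lt].
  by right; rewrite /= e modnn.
by left; rewrite /= modn_small.
Qed.

Lemma ord_pred_cases u :
  (u = 0 :> nat /\ (ord_pred u).+1 = m) \/ u = (ord_pred u).+1 :> nat.
Proof.
have [[lt e]|[e1 e]] := ordS_cases (ord_pred u); rewrite ord_predK in e; lia.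
Qed.

Lemma ord_eqE u v : (u == v) = (u == v :> nat).
Proof. by []. Qed.

Lemma set2_cases (U : finType) (s t s' t' : U) : [set s; t] = [set s'; t'] ->
  s = s' /\ t = t' \/ s = t' /\ t = s'.
Proof.
move=> e; have: s' \in [set s; t] by rewrite e set21.
have: t' \in [set s; t] by rewrite e set22.
have: s \in [set s'; t'] by rewrite -e set21.
have: t \in [set s'; t'] by rewrite -e set22.
by rewrite !inE => /orP[]/eqP-> /orP[]/eqP-> /orP[]/eqP ? /orP[]/eqP ?; auto.
Qed.

Lemma diagonalE u v :
  diagonal [set u; v] = [&& v != u, v != ordS u & u != ordS v].
Proof.
apply/existsP/idP => [[u' /existsP[v' /andP[/eqP/set2_cases]]]|d].
  by case=> [[-> ->]|[-> ->]] // /and3P[n1 n2 n3]; rewrite eq_sym n1 n2 n3.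
by exists u; apply/existsP; exists v; rewrite eqxx.
Qed.

Lemma crossE x0 x1 y0 y1 :
  cross [set x0; x1] [set y0; y1] = cyc4 x1 y1 x0 y0 || cyc4 x1 y0 x0 y1.
Proof.
rewrite /cyc4 !cyc3E; apply/existsP/idP.
  move=> [u /existsP[v /existsP[w /existsP[y]]]].
  move=> /and3P[/eqP/set2_cases xE /eqP/set2_cases yE].
  rewrite /cyc4 !cyc3E.
  by case: xE => [[-> ->]|[-> ->]]; case: yE => [[-> ->]|[-> ->]]; lia.
move=> c; have [c'|c'] := orP c.
  exists x0; apply/existsP; exists x1; apply/existsP; exists y0.
  by apply/existsP; exists y1; rewrite !eqxx /cyc4 !cyc3E.
exists x0; apply/existsP; exists x1; apply/existsP; exists y1.
by apply/existsP; exists y0; rewrite eqxx [[set y1; y0]]setUC eqxx /cyc4 !cyc3E.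
Qed.

Lemma cyc4_rot u v w x : cyc4 u v w x = cyc4 v w x u.
Proof. by rewrite /cyc4 !cyc3E; lia. Qed.

Lemma cyc4_cross u v w x : cyc4 u v w x -> cross [set u; w] [set v; x].
Proof. by rewrite crossE /cyc4 !cyc3E; lia. Qed.

Lemma cyc4_diagonal u v w x : cyc4 u v w x -> diagonal [set u; w].
Proof.
rewrite diagonalE /cyc4 !cyc3E !ord_eqE.
have := ltn_ord v; have := ltn_ord x.
by case: (ordS_cases u); case: (ordS_cases w); lia.
Qed.

Lemma diagonal_shift u v :
  diagonal [set u; v] -> diagonal [set ordS u; ordS v].
Proof. by rewrite !diagonalE !(inj_eq (@ordS_inj m)). Qed.

(** For neighbouring [u] and [w] the interval on the left would wrap around the
    whole polygon. *)
Lemma in_open_interval u w y : diagonal [set u; w] ->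
  (y \in interval (ordS u) (ord_pred w)) = cyc3 u y w.
Proof.
rewrite diagonalE in_intervalE cyc3E !ord_eqE.
have := ltn_ord u; have := ltn_ord w; have := ltn_ord y.
by case: (ordS_cases u); case: (ordS_cases w); case: (ord_pred_cases w); lia.
Qed.

(** The side that cuts [y] off joins the last vertex of [W] before [y] to the
    first one after it; locating its ends between [u] and [w] serves to decide
    which diagonals cross it. *)
Lemma side_around W u w y : u \in W -> w \in W -> cyc3 u y w -> y \notin W ->
  exists u' w', [/\ side W u' w', u' = u \/ cyc3 u u' y, w' = w \/ cyc3 y w' w
    & cyc3 u' y w'].
Proof.
move=> uW wW uyw yW.
have [u' u'W u'max] := @arg_minnP _ u (fun k => k \in W) (fun k => steps k y) uW.
have [w' w'W w'min] := @arg_minnP _ w (fun k => k \in W) (fun k => steps y k) wW.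
have neq k : k \in W -> k != y :> nat.
  by move=> kW; apply: contraNN yW => /eqP/val_inj <-.
have lt (k : 'I_m) := ltn_ord k; have st := steps_cases.
move: (neq _ u'W) (neq _ w'W) (lt y) (lt u') (lt w') (lt u) (lt w).
move: (st u y) (st u' y) (st w y) (st y w) (st y w') (st y u).
move: (u'max u uW) (w'min w wW) (w'min u uW) (u'max w wW) uyw => h1 h2 h3 h4.
rewrite cyc3E => uyw s1 s2 s3 s4 s5 s6 n1 n2 l1 l2 l3 l4 l5.
have y' : cyc3 u' y w' by rewrite cyc3E; lia.
exists u', w'; split=> //.
- rewrite /side u'W w'W /=; apply/andP; split.
    by rewrite ord_eqE; move: y'; rewrite cyc3E; lia.
  apply/forall_inP => k kW.
  move: (neq _ kW) (lt k) (u'max k kW) (w'min k kW) (st k y) (st y k) y'.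
  by rewrite !cyc3E; lia.
- by case: (eqVneq u' u) => [->|]; [left | rewrite ord_eqE cyc3E; right; lia].
by case: (eqVneq w' w) => [->|]; [left | rewrite ord_eqE cyc3E; right; lia].
Qed.

(** The interval starts at [u + 2] because a morphism to [{u, w}] is an
    extension by the diagonal moved one step forward; that diagonal is crossed
    by diagonals ending at [w], which [{u, w}] is not. *)
Lemma hom_interval u w z : diagonal [set u; w] ->
  z \in interval (ordS (ordS u)) w -> z = w \/ cyc3 u z w.
Proof.
rewrite diagonalE !ord_eqE in_intervalE cyc3E => uw zin.
case: (eqVneq z w) => [|zw]; [by left | right; move: zw uw zin].
have := ltn_ord z; have := ltn_ord u; have := ltn_ord w; rewrite ord_eqE.
by have := ordS_cases u; have := ordS_cases (ordS u); lia.
Qed.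

(** A diagonal with a non-zero morphism to [{u, w}] that does not cross [{u, w}]
    shares an endpoint with it; as it also crosses [{y, y'}], its other endpoint
    lies beyond [y] or [y']. *)
Lemma hom_cross_cases u w y y' z0 z1 :
  diagonal [set u; w] -> cyc4 u y w y' ->
  z0 \in interval (ordS (ordS u)) w -> z1 \in interval (ordS (ordS w)) u ->
  ~~ cross [set u; w] [set z0; z1] -> cross [set z0; z1] [set y; y'] ->
  [set z0; z1] != [set u; w] ->
  z1 = u /\ cyc4 u y z0 w \/ z0 = w /\ cyc4 w y' z1 u.
Proof.
move=> uw uywy /(hom_interval uw) z0in; rewrite setUC in uw.
move=> /(hom_interval uw) z1in; rewrite !crossE.
case: z0in z1in => [->|z0in] [->|z1in]; first by rewrite setUC eqxx.
- move=> _ cr _; right; split=> //; move: uywy z1in cr.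
  by rewrite /cyc4 !cyc3E; lia.
- move=> _ cr _; left; split=> //; move: uywy z0in cr.
  by rewrite /cyc4 !cyc3E; lia.
by move: z0in z1in; rewrite /cyc4 !cyc3E; lia.
Qed.

(** A side of [W] around [z] would be crossed by [{u, z}], so it can be neither
    an edge of the polygon nor a dissecting diagonal. *)
Lemma cell_vertex Pt W u y z w : is_cell (dissecting Pt) W ->
  y \in W -> w \in W -> cyc4 u y z w -> [set u; z] \in Pt -> z \in W.
Proof.
move=> [_ sideW _] yW wW uyzw uz; apply: contraT => zW.
have yzw : cyc3 y z w by move: uyzw; rewrite /cyc4 !cyc3E; lia.
have [s [t [st sy tw szt]]] := side_around yW wW yzw zW.
case: (sideW _ _ st) => [tE|].
  move: szt; rewrite tE cyc3E; have := ltn_ord z; have := ordS_cases s; lia.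
rewrite inE => /andP[_ /forall_inP/(_ _ uz)]; rewrite crossE.
case: sy => [->|]; case: tw => [->|]; move: uyzw szt; rewrite /cyc4 !cyc3E; lia.
Qed.

(** A diagonal of [Pt] from [u] that passes [y] would end at a vertex of the
    cell of [y], against the maximality of [y]. *)
Lemma maximal_unpassed Pt W0 W1 (Q : 'I_m -> Prop) u w y z :
  is_cell (dissecting Pt) W0 -> is_cell (dissecting Pt) W1 ->
  borders [set u; w] W0 -> borders [set u; w] W1 -> diagonal [set u; w] ->
  (forall t, t \in W0 :|: W1 -> [set u; t] \in Pt -> Q t) ->
  y \in W0 :|: W1 -> maximal_in (ordS u) (ord_pred w) Q y ->
  [set u; z] \in Pt -> ~~ cyc4 u y z w.
Proof.
move=> cell0 cell1 bd0 bd1 uw_diag QPt yW [_ _ ymax] uzPt; apply/negP => uyzw.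
have bdW W : borders [set u; w] W -> w \in W.
  move=> [s [t [/set2_cases e /and4P[sW tW _ _]]]].
  by case: e => [[_ ->]|[_ ->]].
have zW : z \in W0 :|: W1.
  move: yW; rewrite !inE => /orP[yW|yW].
    by rewrite (cell_vertex cell0 yW (bdW _ bd0) uyzw uzPt).
  by rewrite (cell_vertex cell1 yW (bdW _ bd1) uyzw uzPt) orbT.
have zin : z \in interval (ordS u) (ord_pred w).
  by rewrite in_open_interval //; move: uyzw; rewrite /cyc4 !cyc3E; lia.
have := ymax z zin (QPt z zW uzPt); move: uyzw; rewrite /cyc4 !cyc3E.
have := ltn_ord z; have := ltn_ord y; have := ltn_ord w.
have := steps_cases (ordS u) z; have := steps_cases (ordS u) y.
by have := ordS_cases u; lia.
Qed.

End Polygon.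

(** * The geometric model *)

Section GeometricModel.
Variables (K : fieldType) (T : triCat K) (n : nat) (ob : {set 'I_n.+3} -> T).
Hypothesis obT : geometric_model ob.
Implicit Types (a c d z : {set 'I_n.+3}).

Lemma Ext1_eq0 a c (f : Ext1 (ob a) (ob c)) :
  diagonal a -> diagonal c -> ~~ cross a c -> f = 0.
Proof.
move=> da dc ncr; apply/eqP; rewrite -memv0.
suff <- : fullv = 0%VS :> {vspace Ext1 (ob a) (ob c)} by rewrite memvf.
by apply/eqP; rewrite -dimv_eq0 (gm_ext obT) // (negPf ncr).
Qed.

Lemma Ext1_neq0 a c : diagonal a -> diagonal c -> cross a c ->
  exists f : Ext1 (ob a) (ob c), f <> 0.
Proof.
move=> da dc cr; exists (vpick fullv); apply/eqP.
by rewrite vpick0 -dimv_eq0 (gm_ext obT) // cr.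
Qed.

(** [Hom(z, d)] is [Ext1] of [z] and the inverse shift of [d], hence has
    dimension at most one. *)
Lemma hom_collinear z d (f g : hom (ob z) (ob d)) :
  diagonal z -> diagonal d -> g <> 0 -> exists k : K, f = k *: g.
Proof.
move=> dz dd g0; case/existsP: (dd) => u /existsP[w /andP[/eqP dE _]].
move: dd f g g0; rewrite {}dE => dd f g g0.
have d1 := diagonal_shift dd.
have [phi [psi [psiK phiK]]] := gm_shift obT d1.
rewrite !ordSK in phi psi psiK phiK.
have psig0 : psi \oc g != 0.
  by apply/eqP => e; apply: g0; rewrite -[g]comp1m -phiK -compA e comp0r.
have full : (<[psi \oc g]> == fullv :> {vspace Ext1 (ob z) _})%VS.
  rewrite eqEdim subvf dim_vline psig0 (gm_ext obT) //.
  by case: cross.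
have : psi \oc f \in <[psi \oc g]>%VS by rewrite (eqP full) memvf.
case/vlineP=> a fE; exists a.
by rewrite -[f]comp1m -[g]comp1m -phiK -!compA fE compZr.
Qed.

Lemma ob_neq0 d : diagonal d -> ~ is_zero (ob d).
Proof. by move/(gm_indec obT) => []. Qed.

Lemma ob_brick d : diagonal d -> brick (ob d).
Proof. by move=> dd f; apply: hom_collinear => //; apply: ob_neq0. Qed.

(** Here [w] witnesses that [u] is not the successor of [y]. *)
Lemma ob_diagonal u y w : cyc3 u y w -> ~ is_zero (ob [set u; y]) ->
  diagonal [set u; y].
Proof.
move=> uyw nz; rewrite diagonalE; apply/and3P; split.
- by rewrite ord_eqE; move: uyw; rewrite cyc3E; lia.
- by apply/eqP => yE; apply: nz; rewrite yE; apply: gm_edge.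
rewrite ord_eqE; move: uyw; rewrite cyc3E.
by have := ltn_ord w; have := ordS_cases y; lia.
Qed.

Section ExtProjective.
Variables (C : T -> Prop) (Pt : {set {set 'I_n.+3}}).
Hypotheses (ksT : krull_schmidt T) (CPt : corresponds ob C Pt).
Variables (u w y y' : 'I_n.+3).
Let c := [set u; w].
Let x := [set y; y'].
Hypotheses (c_proj : ext_projective C (ob c)) (uywy : cyc4 u y w y').
Hypotheses (uy_C : C (ob [set u; y])) (wy_C : C (ob [set w; y'])).
Hypothesis y_max : forall z : 'I_n.+3, [set u; z] \in Pt -> ~~ cyc4 u y z w.
Hypothesis y'_max : forall z : 'I_n.+3, [set w; z] \in Pt -> ~~ cyc4 w y' z u.

Let c_diag : diagonal c. Proof. exact: cyc4_diagonal uywy. Qed.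
Let x_diag : diagonal x.
Proof. by move: uywy; rewrite cyc4_rot => /cyc4_diagonal. Qed.

Lemma ext_projective_not_cross d : d \in Pt -> ~~ cross c d.
Proof.
have [_ [Pt_diag _] PtC] := CPt; move=> dPt; apply/negP => cr.
have d_diag := Pt_diag d dPt; have [f] := Ext1_neq0 c_diag d_diag cr.
by case; apply: c_proj.2; apply/PtC.
Qed.

Lemma not_mem_x : ~ C (ob x).
Proof.
have [_ _ PtC] := CPt => /(PtC _ x_diag) /ext_projective_not_cross.
by rewrite (cyc4_cross uywy).
Qed.

(** A non-zero composite would need a diagonal of [Pt] that leaves an endpoint
    of [c], does not cross [c] and crosses [x]: it reaches beyond [y] or [y']. *)
Lemma radical_comp0 (h : Ext1 (ob c) (ob x)) Z (k : hom Z (ob c)) :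
  C Z -> indecomposable Z -> ~ split_epi k -> h \oc k = 0.
Proof.
have [addC [Pt_diag _] PtC] := CPt; move=> CZ indZ nk.
have [d d_diag [phi [psi [psiK phiK]]]] := gm_surj obT indZ.
have dPt : d \in Pt.
  by apply/PtC => //; apply: (asub_iso addC _ CZ); exists phi, psi.
have [kpsi0|kpsi0] := eqVneq (k \oc psi) 0.
  by rewrite -[k]compm1 -psiK [k \oc _]compA kpsi0 comp0l comp0r.
suff hk0 : h \oc (k \oc psi) = 0.
  by rewrite -[k]compm1 -psiK [k \oc _]compA compA hk0 comp0l.
have dc : d != c.
  apply/eqP => dc; move: phi psi psiK phiK kpsi0; rewrite {}dc => phi psi _ _.
  have [l kE] := ob_brick c_diag (k \oc psi) => kpsi0; apply: nk.
  have l0 : l != 0 by apply: contra_neq kpsi0 => l0; rewrite kE l0 scale0r.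
  exists (l^-1 *: psi).
  by rewrite compZr kE scalerA mulVf // scale1r.
apply: Ext1_eq0 => //; apply/negP => dx.
have [|z0 [z1 [dE z0in z1in]]] := (gm_hom obT d_diag c_diag).1.
  by exists (k \oc psi); apply/eqP.
rewrite dE in dx dc dPt; have ncr := ext_projective_not_cross dPt.
case: (hom_cross_cases c_diag uywy z0in z1in ncr dx dc) => [[zE bad]|[zE bad]].
  by move: (y_max (z := z0)); rewrite setUC -zE dPt zE bad => /(_ isT).
by move: (y'_max (z := z1)); rewrite -zE dPt zE bad => /(_ isT).
Qed.

(** The triangle with end terms [x] and [c] has the right middle term.  Its
    components into [c] do not vanish, since neither [{u, y}] nor [{w, y'}] is
    [x]; hence they are multiples of the prescribed ones, and rescaling the
    middle term makes them equal. *)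
Lemma ext_projective_weak_AR (beta0 : hom (ob [set u; y]) (ob c))
    (beta1 : hom (ob [set w; y']) (ob c)) :
  (~ is_zero (ob [set u; y]) -> beta0 <> 0) ->
  (~ is_zero (ob [set w; y']) -> beta1 <> 0) ->
  exists xi0 xi1 delta,
    left_weak_AR_triangle C (col_mor xi0 xi1 : hom (ob x) _)
      (row_mor beta0 beta1) delta.
Proof.
move=> b0_neq0 b1_neq0; have [addC _ PtC] := CPt.
have [h h_neq0] : exists h : Ext1 (ob c) (ob x), h <> 0.
  by apply: Ext1_neq0 => //; apply: cyc4_cross.
have tri_c : exists f (g : hom (dsum (ob [set u; y]) (ob [set w; y'])) (ob c)),
    dist f g h.
  have x4 : cyc4 y' u y w by rewrite cyc4_rot.
  have := (gm_triangle obT x4).1.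
  by rewrite [[set w; u]]setUC => /(_ h h_neq0).
have [f [g tri]] := tri_c.
have brX := ob_brick x_diag; have brc := ob_brick c_diag.
have xn d : diagonal d -> d != x -> ~ isomorphic (ob d) (ob x).
  by move=> dd dx /(gm_inj obT dd x_diag) dE; rewrite dE eqxx in dx.
have uyx : [set u; y] != x.
  apply/eqP => /set2_cases e; move: uywy; rewrite /cyc4 !cyc3E.
  by case: e => [[-> _]|[-> _]]; lia.
have wyx : [set w; y'] != x.
  apply/eqP => /set2_cases e; move: uywy; rewrite /cyc4 !cyc3E.
  by case: e => [[-> _]|[-> _]]; lia.
have uy_diag : ~ is_zero (ob [set u; y]) -> diagonal [set u; y].
  by move: uywy => /andP[uyw _]; apply: ob_diagonal uyw.
have wy_diag : ~ is_zero (ob [set w; y']) -> diagonal [set w; y'].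
  move: uywy; rewrite cyc4_rot cyc4_rot => /andP[wyu _].
  exact: ob_diagonal wyu.
have [|nz|v0 isov0 v0E] := @rescale _ _ _ _ beta0 (g \oc in0 _ _).
- move=> nz; apply: (dist_component_neq0 tri brX (pr0_in0 _ _) nz).
  exact: xn (uy_diag nz) uyx.
- exact: hom_collinear (uy_diag nz) c_diag (b0_neq0 nz).
have [|nz|v1 isov1 v1E] := @rescale _ _ _ _ beta1 (g \oc in1 _ _).
- move=> nz; apply: (dist_component_neq0 tri brX (pr1_in1 _ _) nz).
  exact: xn (wy_diag nz) wyx.
- exact: hom_collinear (wy_diag nz) c_diag (b1_neq0 nz).
pose xi := diag_mor v0 v1 \oc f.
exists (pr0 _ _ \oc xi), (pr1 _ _ \oc xi), h; rewrite col_mor_pr.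
have {}tri : dist xi (row_mor beta0 beta1) h.
  apply: dist_iso_middle tri (is_iso_diag isov0 isov1) _.
  by rewrite row_diag v0E v1E row_mor_in.
have Cb := asub_dsum addC uy_C wy_C.
split=> //; last exact: dist_envelope tri h_neq0 _ Cb c_proj brc.
split; first exact: dist_right_minimal tri h_neq0 brX.
apply: dist_right_almost_split tri h_neq0 Cb c_proj.1 _ => // Z k CZ indZ nk.
exact: radical_comp0.
Qed.

End ExtProjective.
End GeometricModel.

Theorem proposition6p8 (R : realType) (n : nat) (n_gt0 : (0 < n)%N)
  (T : triCat R[i]) (clT : cluster_category_A n T)
  (ksT : krull_schmidt T) (cyT : two_calabi_yau T)
  (ob : {set 'I_n.+3} -> T) (obT : geometric_model ob)
  (C : T -> Prop) (Pt : {set {set 'I_n.+3}}) (CPt : corresponds ob C Pt)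
  (c : {set 'I_n.+3}) (c_diag : diagonal c) (c_proj : ext_projective C (ob c))
  (W0 W1 : {set 'I_n.+3}) (W01 : W0 <> W1)
  (cellW0 : is_cell (dissecting Pt) W0) (cellW1 : is_cell (dissecting Pt) W1)
  (cW0 : borders c W0) (cW1 : borders c W1)
  (m : nat) (v : 'I_m -> 'I_n.+3)
  (v_vert : forall w, w \in W0 :|: W1 <-> exists k, w = v k)
  (v_incr : forall k1 k2 k3 : 'I_m, (k1 < k2)%N -> (k2 < k3)%N ->
     cyc3 (v k1) (v k2) (v k3))
  (i j : 'I_m) (c_ij : c = [set v i; v j])
  (p q : 'I_m)
  (p_max : maximal_in (ordS (v i)) (ord_pred (v j))
     (fun w => (exists k, w = v k) /\ C (ob [set v i; w])) (v p))
  (q_max : maximal_in (ordS (v j)) (ord_pred (v i))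
     (fun w => (exists k, w = v k) /\ C (ob [set v j; w])) (v q)) :
  let b0 := ob [set v i; v p] in
  let b1 := ob [set v j; v q] in
  let x := ob [set v p; v q] in
  forall (beta0 : hom b0 (ob c)) (beta1 : hom b1 (ob c)),
    (~ is_zero b0 -> beta0 <> 0) -> (~ is_zero b1 -> beta1 <> 0) ->
    let beta := row_mor beta0 beta1 in
    [/\ minimal_right_almost_split C beta,
        indecomposable x, ~ C x
      & exists (xi0 : hom x b0) (xi1 : hom x b1) (d : hom (ob c) (shift T x)),
          let xi := col_mor xi0 xi1 in
          [/\ dist xi beta d, envelope C xi
            & left_weak_AR_triangle C xi beta d]].
Proof.
have [_ [Pt_diag _] PtC] := CPt.
move=> b0 b1 x beta0 beta1 b0_neq0 b1_neq0 beta; subst c.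
set u := v i in c_diag c_proj cW0 cW1 p_max q_max *.
set w := v j in c_diag c_proj cW0 cW1 p_max q_max *.
have wu_diag : diagonal [set w; u] by rewrite setUC.
have vW k : v k \in W0 :|: W1 by apply/v_vert; exists k.
have inC s t : t \in W0 :|: W1 -> [set s; t] \in Pt ->
    (exists k, t = v k) /\ C (ob [set s; t]).
  by move=> /v_vert tv tPt; split=> //; apply/PtC => //; apply: Pt_diag.
have uywy : cyc4 u (v p) w (v q).
  have [+ _ _] := p_max; have [+ _ _] := q_max.
  by rewrite !in_open_interval // /cyc4 !cyc3E; lia.
have [_ [_ uy_C] _] := p_max; have [_ [_ wy_C] _] := q_max.
have p_unpassed z : [set u; z] \in Pt -> ~~ cyc4 u (v p) z w.
  exact: (maximal_unpassed cellW0 cellW1 cW0 cW1 c_diag (inC u) (vW p) p_max).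
have q_unpassed z : [set w; z] \in Pt -> ~~ cyc4 w (v q) z u.
  apply: (maximal_unpassed cellW0 cellW1 _ _ wu_diag (inC w) (vW q) q_max);
  by rewrite setUC.
have [xi0 [xi1 [delta ar]]] := ext_projective_weak_AR obT ksT CPt c_proj uywy
  uy_C wy_C p_unpassed q_unpassed b0_neq0 b1_neq0.
have [tri _ mras env] := ar.
split=> //; last by exists xi0, xi1, delta.
  apply: (gm_indec obT); apply: (cyc4_diagonal (v := w) (x := u)).
  by move: uywy; rewrite cyc4_rot.
exact (not_mem_x obT CPt c_proj uywy).
Qed.
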